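(* Let $K\ge1$ and let $\mathbb D_1,\dots,\mathbb D_K\in\mathbb R^2$ be pairwise distinct points (detectors). (Sufficiency) If the detectors $\mathbb D_1,\dots,\mathbb D_K$ do not lay on a cross, then the system with these $K$ detectors is identifiable (for any set $\Theta\subset\mathbb R^4$ of admissible positions of the two sources). (Necessity without restrictions on the sources) If $\Theta=\mathbb R^4$, this condition is also necessary: if the system is identifiable with $\Theta=\mathbb R^4$, then the detectors do not lay on a cross.
   Context: Points $A_1,\dots,A_n\in\mathbb R^2$ are said to *lay on a cross* if there exists a pair of orthogonal lines $\ell_1,\ell_2$ in the plane such that $A_i\in\ell_1\cup\ell_2$ for all $i=1,\dots,n$. A pair of sources is an unordered pair (multiset) $\{\mathbb S_1,\mathbb S_2\}$ of points of $\mathbb R^2$, possibly coinciding; it is admissible if $(\mathbb S_1,\mathbb S_2)\in\Theta\subset\mathbb R^4$ for some ordering. It provides to the detector $\mathbb D_k$ the unordered pair (multiset) of Euclidean distances $\{\|\mathbb D_k-\mathbb S_1\|,\|\mathbb D_k-\mathbb S_2\|\}$ (it is not known which distance corresponds to which source). The system with detectors $\mathbb D_1,\dots,\mathbb D_K$ (the two signals received by each detector being identical in shape) is *identifiable* if there exist no two different admissible pairs of sources $\{\mathbb S_1,\mathbb S_2\}\neq\{\mathbb S_1',\mathbb S_2'\}$ which provide the same $K$ pairs of distances to the detectors, i.e. such that $\{\|\mathbb D_k-\mathbb S_1\|,\|\mathbb D_k-\mathbb S_2\|\}=\{\|\mathbb D_k-\mathbb S_1'\|,\|\mathbb D_k-\mathbb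 S_2'\|\}$ as multisets for every $k=1,\dots,K$. *)

(* Defs.v *)
From mathcomp Require Import all_boot all_order all_algebra.
From mathcomp Require Import classical_sets reals.

Set Implicit Arguments.
Unset Strict Implicit.
Unset Printing Implicit Defensive.

Import Order.TTheory GRing.Theory Num.Theory.
Local Open Scope classical_set_scope.
Local Open Scope ring_scope.

Definition dotv (R : realType) (u v : 'rV[R]_2) : R :=
  \sum_(i < 2) u 0 i * v 0 i.

(* The norm `|_| that MathComp-Analysis puts on matrices is the sup norm, so
   the Euclidean distance is defined explicitly. *)
Definition edist (R : realType) (P Q : 'rV[R]_2) : R :=
  Num.sqrt (dotv (P - Q) (P - Q)).

(* Only a line when u != 0. *)
Definition line (R : realType) (P u : 'rV[R]_2) : set 'rV[R]_2 :=
  [set P + t *: u | t in [set: R]].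

Definition orthogonal_lines (R : realType) (l1 l2 : set 'rV[R]_2) : Prop :=
  exists P1 u1 P2 u2 : 'rV[R]_2,
    [/\ u1 != 0, u2 != 0, l1 = line P1 u1, l2 = line P2 u2 & dotv u1 u2 = 0].

Definition lay_on_cross (R : realType) (n : nat) (A : 'I_n -> 'rV[R]_2) : Prop :=
  exists l1 l2 : set 'rV[R]_2,
    orthogonal_lines l1 l2 /\ forall i, (l1 `|` l2) (A i).

(* Equality {a, b} = {c, d} of unordered pairs, as multisets. *)
Definition same_pair (T : eqType) (a b c d : T) : bool :=
  perm_eq [:: a; b] [:: c; d].

(* R^2 x R^2 is identified with R^4 by concatenating coordinates. *)
Definition admissible (R : realType) (Theta : set 'rV[R]_4)
    (S1 S2 : 'rV[R]_2) : Prop :=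
  Theta (row_mx S1 S2) \/ Theta (row_mx S2 S1).

Definition identifiable (R : realType) (K : nat) (Theta : set 'rV[R]_4)
    (D : 'I_K -> 'rV[R]_2) : Prop :=
  ~ exists S1 S2 S1' S2' : 'rV[R]_2,
      [/\ admissible Theta S1 S2,
          admissible Theta S1' S2',
          ~~ same_pair S1 S2 S1' S2' &
          forall k : 'I_K,
            same_pair (edist (D k) S1) (edist (D k) S2)
                      (edist (D k) S1') (edist (D k) S2')].

(* Main.v *)
Require Import Defs.
From mathcomp Require Import all_boot all_order all_algebra.
From mathcomp Require Import classical_sets reals.
From mathcomp Require Import ring lra.

(** A detector receiving the same distances from {S1, S2} and {S1', S2'} lies
    either on the bisectors of S1 S1' and S2 S2', or on those of S1 S2' and
    S2 S1'.  In both cases the sums of its squared distances to the two pairs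
    agree, which is an affine equation with normal S1 + S2 - S1' - S2'.  If this
    normal is nonzero, all detectors are on one line.  If it vanishes, the four
    sources form a parallelogram and the equation says that its diagonals have
    equal length: it is a rectangle, and the bisectors of its adjacent sides
    S1 S1' and S1 S2' are orthogonal.  Conversely the vertices of a rectangle
    whose axes of symmetry are the two lines of a cross, split into the two
    pairs of opposite vertices, defeat all detectors on that cross. *)

Import Order.TTheory GRing.Theory Num.Theory.
Local Open Scope classical_set_scope.
Local Open Scope ring_scope.

Lemma same_pairE (T : eqType) (a b c d : T) :
  same_pair a b c d = (a == c) && (b == d) || (a == d) && (b == c).
Proof.
have aux (x y z : T) : perm_eq [:: x; y] [:: x; z] = (y == z).
  rewrite perm_cons; apply/idP/eqP => [|-> //].
  by move/perm_small_eq => /(_ isT) [].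
rewrite /same_pair; apply/idP/orP; last first.
  case=> /andP[/eqP -> /eqP ->] //.
  by rewrite (perm_catC [:: d] [:: c]).
move=> h; have := perm_mem h a; rewrite !inE eqxx /= => /esym/orP[]/eqP ac.
  by left; move: h; rewrite ac aux eqxx.
by right; move: h; rewrite ac (perm_sym [:: d; b]) (perm_catC [:: c] [:: d])
  perm_sym aux eqxx.
Qed.

Section PlaneGeometry.
Variable R : realType.
Implicit Types (u v P Q S : 'rV[R]_2) (c : R).

Lemma dotvE u v : dotv u v = u 0 0 * v 0 0 + u 0 1 * v 0 1.
Proof.
by rewrite /dotv !big_ord_recl big_ord0 addr0; congr (_ + u _ _ * v _ _);
  apply: val_inj.
Qed.

Lemma rV2P u v : u 0 0 = v 0 0 -> u 0 1 = v 0 1 -> u = v.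
Proof.
move=> h0 h1; apply/rowP => -[[|[|//]] i].
  by rewrite (_ : Ordinal i = 0) //; apply: val_inj.
by rewrite (_ : Ordinal i = 1) //; apply: val_inj.
Qed.

Lemma dotv_ge0 u : 0 <= dotv u u.
Proof. by rewrite dotvE -!expr2 addr_ge0 ?sqr_ge0. Qed.

Lemma dotv_eq0 u : (dotv u u == 0) = (u == 0).
Proof.
apply/idP/eqP => [|->]; last by rewrite dotvE !mxE !mul0r addr0.
rewrite dotvE -!expr2 paddr_eq0 ?sqr_ge0 // !sqrf_eq0 => /andP[/eqP h0 /eqP h1].
by apply: rV2P; rewrite mxE.
Qed.

(** After squaring, the quadratic terms in [P] cancel: what remains is affine in [P], the
    perpendicular bisector when [S] and [S'] differ. *)
Lemma edist_eqP P S S' :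
  edist P S = edist P S' <-> 2 * dotv (S - S') P = dotv S S - dotv S' S'.
Proof.
rewrite /edist; split.
  move/eqP; rewrite eqr_sqrt ?dotv_ge0 // => /eqP.
  by rewrite !dotvE !mxE => h; lra.
move=> h; congr Num.sqrt; move: h.
by rewrite !dotvE !mxE => h; lra.
Qed.

Definition rot90 u : 'rV[R]_2 := \row_i (if i == 0 then - u 0 1 else u 0 0).

Lemma rot90_eq0 u : (rot90 u == 0) = (u == 0).
Proof. by rewrite -!dotv_eq0 !dotvE !mxE /= mulrNN addrC. Qed.

Lemma dotv_rot90 u v : dotv (rot90 u) (rot90 v) = dotv u v.
Proof. by rewrite !dotvE !mxE /= mulrNN addrC. Qed.

Lemma hyperplane_line u c P : u != 0 ->
  dotv u P = c -> line ((c / dotv u u) *: u) (rot90 u) P.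
Proof.
(* The base point is the foot of the perpendicular from the origin. *)
rewrite -dotv_eq0 => u0 <-; exists (dotv (rot90 u) P / dotv u u) => //.
by apply: rV2P; move: u0; rewrite !dotvE !mxE /= => u0; field.
Qed.

Lemma lay_on_cross_eqn (K : nat) (D : 'I_K -> 'rV[R]_2) u v c d :
    u != 0 -> v != 0 -> dotv u v = 0 ->
    (forall k, dotv u (D k) = c \/ dotv v (D k) = d) ->
  lay_on_cross D.
Proof.
move=> u0 v0 uv h.
exists (line ((c / dotv u u) *: u) (rot90 u)).
exists (line ((d / dotv v v) *: v) (rot90 v)); split.
  exists ((c / dotv u u) *: u), (rot90 u), ((d / dotv v v) *: v), (rot90 v).
  by split; rewrite ?rot90_eq0 ?dotv_rot90.
by move=> k; case: (h k) => hk; [left|right]; apply: hyperplane_line.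
Qed.

Lemma lay_on_cross_eqnP (K : nat) (D : 'I_K -> 'rV[R]_2) :
  lay_on_cross D -> exists u v c d,
    [/\ u != 0, v != 0, dotv u v = 0
      & forall k, dotv u (D k) = c \/ dotv v (D k) = d].
Proof.
move=> [_ [_ [[P [u [Q [v [u0 v0 -> -> uv]]]]] h]]].
(* By orthogonality, the direction of each line is a normal of the other, hence the crossed base
   points. *)
exists u, v, (dotv u Q), (dotv v P); split=> // k.
case: (h k) => -[t _ <-]; [right|left]; move: uv; rewrite !dotvE !mxE => uv.
  by rewrite -[RHS]addr0 -(mulr0 t) -uv; ring.
by rewrite -[RHS]addr0 -(mulr0 t) -uv; ring.
Qed.

Lemma not_identifiable_cross (K : nat) (D : 'I_K -> 'rV[R]_2) u v c d :
    u != 0 -> v != 0 -> dotv u v = 0 ->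
    (forall k, dotv u (D k) = c \/ dotv v (D k) = d) ->
  ~ identifiable [set: 'rV[R]_4] D.
Proof.
move=> u0 v0 uv h; apply.
(* The centre of the cross. *)
pose O := (c / dotv u u) *: u + (d / dotv v v) *: v.
have Ou : dotv u O = c.
  transitivity (c / dotv u u * dotv u u + d / dotv v v * dotv u v).
    by rewrite /O; set x := c / _; set y := d / _; rewrite !dotvE !mxE; ring.
  by rewrite uv mulr0 addr0 divfK ?dotv_eq0.
have Ov : dotv v O = d.
  transitivity (c / dotv u u * dotv u v + d / dotv v v * dotv v v).
    by rewrite /O; set x := c / _; set y := d / _; rewrite !dotvE !mxE; ring.
  by rewrite uv mulr0 add0r divfK ?dotv_eq0.
clearbody O.
have neqN (w : 'rV[R]_2) : w != 0 -> w != - w.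
  by rewrite -addr_eq0 -mulr2n -scaler_nat scaler_eq0 pnatr_eq0.
exists (O + (u + v)), (O - (u + v)), (O + (u - v)), (O - (u - v)).
split; [by left|by left| |].
  rewrite same_pairE; apply/negP => /orP[]/andP[/eqP + _].
    by move/addrI/addrI/eqP; apply/negP/neqN.
  by rewrite opprB [v - u]addrC => /addrI/addIr/eqP; apply/negP/neqN.
move=> k; rewrite same_pairE; apply/orP.
(* Reflection in the line with normal [u] swaps [O + (u + v)] and [O - (u - v)]; the one with normal
   [v] swaps [O + (u + v)] and [O + (u - v)]. *)
by case: (h k) => hk; [right|left]; apply/andP; split; apply/eqP/edist_eqP;
  move: uv Ou Ov hk; rewrite !dotvE !mxE; clear => *; lra.
Qed.

Lemma same_distances_cross (K : nat) (D : 'I_K -> 'rV[R]_2) S1 S2 S1' S2' :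
    (0 < K)%N -> ~~ same_pair S1 S2 S1' S2' ->
    (forall k, same_pair (edist (D k) S1) (edist (D k) S2)
                         (edist (D k) S1') (edist (D k) S2')) ->
  lay_on_cross D.
Proof.
move=> K0 neqS h.
have sumE k : 2 * dotv (S1 + S2 - S1' - S2') (D k) =
    dotv S1 S1 + dotv S2 S2 - dotv S1' S1' - dotv S2' S2'.
  have := h k; rewrite same_pairE => /orP[]/andP[/eqP/edist_eqP + /eqP/edist_eqP];
  by rewrite !dotvE !mxE; clear => *; lra.
have [n0|n0] := eqVneq (S1 + S2 - S1' - S2') 0; last first.
  (* All detectors are on the first line; the second may be any perpendicular, here the one through
     the origin. *)
  apply: (@lay_on_cross_eqn _ D _ (rot90 (S1 + S2 - S1' - S2'))
    ((dotv S1 S1 + dotv S2 S2 - dotv S1' S1' - dotv S2' S2') / 2) 0 n0).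
  - by rewrite rot90_eq0.
  - by rewrite !dotvE !mxE /=; ring.
  - by move=> k; left; rewrite -(sumE k) mulrAC divff ?mul1r ?pnatr_eq0.
have S2'E : S2' = S1 + S2 - S1'.
  by apply/esym/eqP; rewrite -subr_eq0 n0.
move: neqS; rewrite same_pairE S2'E negb_or.
(* In a parallelogram, one coincidence in a matching of the sources forces the other. *)
have -> : (S2 == S1 + S2 - S1') = (S1 == S1').
  by rewrite eq_sym -subr_eq0 addrAC addrK subr_eq0.
have S1E : (S1 == S1 + S2 - S1') = (S2 == S1').
  by rewrite eq_sym -subr_eq0 addrAC [S1 + S2]addrC addrK subr_eq0.
rewrite S1E !andbb => /andP[a0 b0].
apply: (@lay_on_cross_eqn _ D (S1 - S1') (S1 - S2')
   ((dotv S1 S1 - dotv S1' S1') / 2) ((dotv S1 S1 - dotv S2' S2') / 2)).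
- by rewrite subr_eq0.
- by rewrite subr_eq0 S2'E S1E.
(* One detector is enough: the left side of [sumE] vanishes, and the right side is twice the dot
   product of [S1 - S1'] and [S2' - S1], up to sign. *)
- have := sumE (Ordinal K0); rewrite n0 S2'E !dotvE !mxE; clear => *; lra.
move=> k; have := h k; rewrite same_pairE.
by case/orP=> /andP[/eqP/edist_eqP <- _]; [left|right];
  rewrite mulrAC divff ?mul1r ?pnatr_eq0.
Qed.

End PlaneGeometry.

Theorem theorem4 (R : realType) (K : nat) (K_ge1 : (1 <= K)%N)
    (D : 'I_K -> 'rV[R]_2) (D_distinct : injective D) :
  (~ lay_on_cross D -> forall Theta : set 'rV[R]_4, identifiable Theta D) /\
  (identifiable [set: 'rV[R]_4] D -> ~ lay_on_cross D).
Proof.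
split=> [ncross Theta [S1 [S2 [S1' [S2' [_ _ neqS eqd]]]]]|idD].
  by apply: ncross; exact: (same_distances_cross _ _ D S1 S2 S1' S2').
move=> /lay_on_cross_eqnP[u [v [c [d [u0 v0 uv h]]]]].
exact: (not_identifiable_cross _ _ D u v c d).
Qed.
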